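(* Let $m\ge 1$ and let $X\subset \sqrt{m}\,\mathbb{S}^{m-1}=\{\bm{x}\in\mathbb{R}^m:\bm{x}\cdot\bm{x}=m\}$ be a spherical $2$-design with $|X|=n$ which is an $s$-distance set and whose degree $S$ equals $s$. Let $F_0,\dots,F_s$ be its projection matrices, let $m_s(\bm{x})=n(F_s)_{\bm{x},\bm{x}}$ for $\bm{x}\in X$, and let $q_s$ be the predegree polynomial of degree $s$ of $X$. Then \[ \mathrm{tr}\, F_s=\frac{1}{n}\sum_{\bm{x}\in X} m_s(\bm{x})\le q_s(m), \] and equality holds if and only if $X$ has the structure of a $Q$-polynomial association scheme with respect to the idempotents $F_0,\dots,F_s$.
   Context: Setting: $\bm{x}\cdot\bm{y}$ is the standard inner product on $\mathbb{R}^m$; $X$ is a finite subset of $\sqrt{m}\,\mathbb{S}^{m-1}$ with $n=|X|$. Put $A(X)=\{\bm{x}\cdot\bm{y}:\bm{x},\bm{y}\in X,\ \bm{x}\ne\bm{y}\}$ and $A'(X)=A(X)\cup\{m\}$; $X$ is an $s$-distance set if $|A(X)|=s$. $X$ is a spherical $2$-design if the average of every polynomial of degree at most $2$ over $X$ equals its average over the sphere with respect to the Lebesgue measure (equivalently, $\sum_{\bm{y}\in X}\bm{x}\cdot\bm{y}=0$ and $\frac1n\sum_{\bm{z}\in X}(\bm{x}\cdot\bm{z})(\bm{z}\cdot\bm{y})=\bm{x}\cdot\bm{y}$ for all $\bm{x},\bm{y}\in X$). Functions: $C(X)$ is the space of real functions on $X$ with inner product $(f,g)=\frac1n\sum_{\bm{x}\in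 X}f(\bm{x})g(\bm{x})$. For $p\in\mathbb{R}[t]$ and $\bm{a}\in X$, $\zeta_{\bm{a}}(p)(\bm{x})=p(\bm{a}\cdot\bm{x})$. $\mathrm{Pol}_0(X)$ = constant functions; $\mathrm{Pol}_1(X)=\mathrm{Span}\{\zeta_{\bm a}(p):\bm a\in X,\deg p\le 1\}$; $\mathrm{Pol}_k(X)=\mathrm{Span}\{fg: f\in\mathrm{Pol}_1(X), g\in\mathrm{Pol}_{k-1}(X)\}$ for $k\ge2$ (equivalently $\mathrm{Pol}_k(X)=\mathrm{Span}\{\zeta_{\bm a}(p):\bm a\in X,\deg p\le k\}$). The degree of $X$ is $S=\min\{i:\mathrm{Pol}_i(X)=C(X)\}$. $\mathrm{Harm}_0(X)=\mathrm{Pol}_0(X)$ and $\mathrm{Harm}_k(X)=\mathrm{Pol}_k(X)\cap\mathrm{Pol}_{k-1}(X)^\perp$ for $k\ge1$. Matrices $M$ indexed by $X\times X$ act on $C(X)$ by $(Mf)(\bm x)=\sum_{\bm y}M_{\bm x,\bm y}f(\bm y)$; $F_i$ ($0\le i\le S$) is the matrix of the orthogonal projection of $C(X)$ onto $\mathrm{Harm}_i(X)$ (the projection matrices of $X$). Gram matrix and polynomials: $G=\frac1n(\bm x\cdot\bm y)_{\bm x,\bm y\in X}$. For a matrix $M$ and $p\in\mathbb{R}[t]$, $p(M^\circ)$ is the matrix obtained by applying $p$ entrywise. For $\alpha\in A'(X)$, $\kappa_\alpha=|\{(\bm x,\bm y)\in X^2:\bm x\cdot\bm y=\alpha\}|$.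 On $\mathbb{R}[t]/(\prod_{\alpha\in A'(X)}(t-\alpha))$ define $\langle p,q\rangle=\frac1{n^2}\sum_{\alpha\in A'(X)}\kappa_\alpha p(\alpha)q(\alpha)$. The predegree polynomials $q_0,\dots,q_s$ of $X$ are the polynomials with $\deg q_k=k$ and $\langle q_k,q_h\rangle=\delta_{k,h}q_k(m)$. Association schemes: for $\alpha\in A'(X)$ let $R_\alpha=\{(\bm x,\bm y)\in X^2:\bm x\cdot\bm y=\alpha\}$. ''$X$ has the structure of a $Q$-polynomial association scheme with respect to the idempotents $F_0,\dots,F_s$'' means: $(X,\{R_\alpha\}_{\alpha\in A'(X)})$ is a symmetric association scheme (its adjacency matrices span an algebra closed under matrix multiplication, with the usual axioms), its primitive idempotents are $F_0,\dots,F_s$, and for each $i$ there is a polynomial $v_i^*$ of degree $i$ with $nF_i=v_i^*((nF_1)^\circ)$. *)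

(* Defs.v *)
From HB Require Import structures.
From mathcomp Require Import all_boot all_order all_algebra.
From mathcomp Require Import reals.
Set Implicit Arguments. Unset Strict Implicit. Unset Printing Implicit Defensive.
Import Order.TTheory GRing.Theory Num.Theory.
Local Open Scope ring_scope.

Section Defs.
Variable R : realType.
(* X = { x i | i < n } ⊂ R^m, points as row vectors; injectivity of x is a
   separate hypothesis of the theorem. *)
Variables (m n : nat) (x : 'I_n -> 'rV[R]_m).

Definition dotv (u v : 'rV[R]_m) : R := \sum_(i < m) u 0 i * v 0 i.

Definition on_sphere : Prop := forall i, dotv (x i) (x i) = m%:R.

Definition Aset : seq R :=
  undup [seq dotv (x ij.1) (x ij.2) | ij <- enum [set: 'I_n * 'I_n] & ij.1 != ij.2].
Definition Aprime : seq R := undup (m%:R :: Aset).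
Definition kappa (a : R) : nat :=
  #|[set ij : 'I_n * 'I_n | dotv (x ij.1) (x ij.2) == a]|.

Definition design2 : Prop :=
  (forall i, \sum_(j < n) dotv (x i) (x j) = 0) /\
  (forall i j, n%:R^-1 * \sum_(k < n) dotv (x i) (x k) * dotv (x k) (x j)
               = dotv (x i) (x j)).

(* C(X) = row vectors indexed by 'I_n, f 0 j = f(x j); inner product (f,g) *)
Definition cip (f g : 'rV[R]_n) : R := n%:R^-1 * \sum_(j < n) f 0 j * g 0 j.

Definition zeta (a : 'I_n) (p : {poly R}) : 'rV[R]_n :=
  \row_j p.[dotv (x a) (x j)].

Definition hprod (f g : 'rV[R]_n) : 'rV[R]_n := \row_j (f 0 j * g 0 j).
Definition const1 : 'rV[R]_n := const_mx 1.

(* spanning family of Pol_1 : zeta_a(p) for p in the basis {1, t} of deg<=1 *)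
Definition gens1 : seq 'rV[R]_n :=
  [seq zeta a p | a <- enum 'I_n, p <- [:: 1; 'X]].

(* spanning families: Pol_0 = constants, Pol_{k+1} = Span{f g : f in Pol_1,
   g in Pol_k}; by bilinearity it is spanned by products of spanning vectors *)
Fixpoint gens (k : nat) : seq 'rV[R]_n :=
  match k with
  | 0 => [:: const1]
  | k'.+1 => [seq hprod u v | u <- gens1, v <- gens k']
  end.

Definition Pol (k : nat) : 'M[R]_n := (\sum_(v <- gens k) <<v>>)%MS.
Definition inPol (k : nat) (f : 'rV[R]_n) : bool := (f <= Pol k)%MS.

Definition Harm (k : nat) (f : 'rV[R]_n) : Prop :=
  inPol k f /\
  (if k is k'.+1 then forall g, inPol k' g -> cip f g = 0 else True).

Definition is_degree (S : nat) : Prop :=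
  (forall f : 'rV[R]_n, inPol S f) /\
  (forall i, (i < S)%N -> exists f : 'rV[R]_n, ~~ inPol i f).

Definition act (M : 'M[R]_n) (f : 'rV[R]_n) : 'rV[R]_n :=
  \row_a \sum_(b < n) M a b * f 0 b.

Definition is_orth_proj (M : 'M[R]_n) (W : 'rV[R]_n -> Prop) : Prop :=
  forall f, W (act M f) /\ (forall g, W g -> cip (f - act M f) g = 0).

(* <p,q> on R[t]/(prod_{a in A'} (t - a)) *)
Definition pred_ip (p q : {poly R}) : R :=
  (n%:R ^+ 2)^-1 * \sum_(a <- Aprime) (kappa a)%:R * p.[a] * q.[a].

Definition predegree (s : nat) (q : nat -> {poly R}) : Prop :=
  forall k h, (k <= s)%N -> (h <= s)%N ->
    size (q k) = k.+1 /\
    pred_ip (q k) (q h) = (if k == h then (q k).[m%:R] else 0).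

Definition rel (a : R) (i j : 'I_n) : bool := dotv (x i) (x j) == a.
Definition adj (a : R) : 'M[R]_n := \matrix_(i, j) (rel a i j)%:R.

Definition sym_assoc_scheme : Prop :=
  [/\ exists2 a0, a0 \in Aprime & (forall i j, rel a0 i j = (i == j)),
      (forall i j, exists! a, a \in Aprime /\ rel a i j),
      (forall a, a \in Aprime -> exists i j, rel a i j),
      (forall a i j, rel a i j = rel a j i) &
      (forall a b c, a \in Aprime -> b \in Aprime -> c \in Aprime ->
         forall i j i' j', rel c i j -> rel c i' j' ->
         #|[set z | rel a i z && rel b z j]| = #|[set z | rel a i' z && rel b z j']|)].

Definition inBM (E : 'M[R]_n) : bool :=
  (mxvec E <= \sum_(a <- Aprime) <<mxvec (adj a)>>)%MS.

Definition primitive_idem (E : 'M[R]_n) : Prop :=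
  [/\ inBM E, E *m E = E, E != 0 &
      forall E', inBM E' -> E' *m E' = E' -> E' *m E = E' -> E' = 0 \/ E' = E].

Definition qpoly_scheme (s : nat) (F : nat -> 'M[R]_n) : Prop :=
  [/\ sym_assoc_scheme,
      (forall E, primitive_idem E <-> exists2 i, (i <= s)%N & E = F i) &
      (forall i, (i <= s)%N -> exists v : {poly R},
         size v = i.+1 /\
         forall a b, n%:R * F i a b = v.[n%:R * F 1%N a b])].

End Defs.

(* Main.v *)
Require Import Defs.
From HB Require Import structures.
From mathcomp Require Import all_boot all_order all_algebra.
From mathcomp Require Import reals.
From mathcomp Require Import ring.
Import Order.TTheory GRing.Theory Num.Theory.
Local Open Scope ring_scope.

Set Implicit Arguments. Unset Strict Implicit. Unset Printing Implicit Defensive.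

(** Write [p°] for the matrix [n^-1 p(x_i . x_j)]; then [pred_ip p r] is the trace
    of [p° r°].  The row-orthogonality of the values of the predegree polynomials
    on the [s + 1] inner products gives, by squareness, the column-orthogonality,
    whence [sum_k (q k)° = 1].  Since [F s] kills [Pol (s - 1)], this yields
    [F s * (q s)° = F s], so that [|(q s)° - F s|^2 = q_s(m) - tr (F s)]: this is
    the inequality, with equality exactly when [F s = (q s)°].  From there
    [F k = (q k)°] propagates downwards: by the 2-design property the entrywise
    product of [F k.+1] with the Gram matrix is a sum of [D F k.+1 D] with [D]
    diagonal in [Pol 1], hence orthogonal to [Pol (k - 1)], and its expansion
    along the [(q j)°] involves [(q k)°] and otherwise only the [F j] with
    [j > k].  So all the [F k] are polynomials in the entries of the Gram matrix
    and span the adjacency matrices.  Conversely, if [F s = v°] with [v] of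
    degree [s], then [v] is a multiple of [q s] and idempotency fixes the
    factor. *)

(** * Traces, spans of lists of matrices, and cancellation of leading terms *)

Lemma mxtrace_mul_tr (R : comPzRingType) (p n : nat) (A : 'M[R]_(p, n)) :
  \tr (A *m A^T) = \sum_i \sum_j A i j ^+ 2.
Proof.
rewrite /mxtrace; apply: eq_bigr => i _; rewrite !mxE.
by apply: eq_bigr => j _; rewrite !mxE expr2.
Qed.

Lemma mxtrace_mul_tr_ge0 (R : realDomainType) (p n : nat) (A : 'M[R]_(p, n)) :
  0 <= \tr (A *m A^T).
Proof.
by rewrite mxtrace_mul_tr; do 2!apply: sumr_ge0 => ? _; apply: sqr_ge0.
Qed.

Lemma mxtrace_mul_tr_eq0 (R : realDomainType) (p n : nat) (A : 'M[R]_(p, n)) :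
  \tr (A *m A^T) = 0 -> A = 0.
Proof.
rewrite mxtrace_mul_tr => /eqP.
rewrite psumr_eq0 => [/allP hA|i _]; last by apply: sumr_ge0 => j _; apply: sqr_ge0.
apply/matrixP=> i j; rewrite mxE; apply/eqP.
move/implyP: (hA i (mem_index_enum i)) => /(_ isT).
rewrite psumr_eq0 => [/allP hAi|k _]; last exact: sqr_ge0.
by move/implyP: (hAi j (mem_index_enum j)) => /(_ isT); rewrite sqrf_eq0.
Qed.

Lemma sub_bigaddsmx_seq (F : fieldType) (I : eqType) (r : seq I) (n p : nat)
    (B : I -> 'M[F]_(p, n)) (i : I) :
  i \in r -> (B i <= \sum_(j <- r) <<B j>>)%MS.
Proof.
move=> ir; rewrite (big_rem i ir) /= (submx_trans _ (addsmxSl _ _)) //.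
by rewrite genmxE.
Qed.

Lemma bigaddsmx_seqMr_sub (F : fieldType) (I : eqType) (r : seq I)
    (n p l o : nat) (B : I -> 'M[F]_(p, n)) (D : 'M[F]_(n, o)) (C : 'M[F]_(l, o)) :
  (forall i, i \in r -> (B i *m D <= C)%MS) ->
  ((\sum_(j <- r) <<B j>>)%MS *m D <= C)%MS.
Proof.
elim: r => [|i r IH] h; first by rewrite big_nil mul0mx sub0mx.
rewrite big_cons addsmxMr addsmx_sub (eqmxMr _ (genmxE _)) h ?mem_head //=.
by apply: IH => j jr; apply: h; rewrite in_cons jr orbT.
Qed.

Lemma size_sub_lead (F : fieldType) (p q : {poly F}) : q != 0 ->
  size p = size q ->
  (size (p - (lead_coef p / lead_coef q) *: q)%R < size q)%N.
Proof.
move=> q0 sp; have sq : (size q).-1.+1 = size q by rewrite prednK // size_poly_gt0.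
rewrite -[X in (_ < X)%N]sq ltnS; apply/leq_sizeP=> i ji; rewrite coefB coefZ.
have [<-|nij] := eqVneq (size q).-1 i.
  by rewrite -{1}sp -!lead_coefE divfK ?subrr // lead_coef_eq0.
have ij : (size q <= i)%N by rewrite -sq ltn_neqAle nij.
by rewrite !nth_default ?mulr0 ?subr0 // sp.
Qed.

(** * Inner products between points of the sphere *)

Section SphericalSet.
Variables (R : realType) (m n : nat) (x : 'I_n -> 'rV[R]_m).

Local Notation dot i j := (dotv (x i) (x j)).

Lemma dotvC (u v : 'rV[R]_m) : dotv u v = dotv v u.
Proof. by apply: eq_bigr => i _; rewrite mulrC. Qed.

(** The squared distance [|u|^2 + |v|^2 - 2 u.v] vanishes when all three products equal [r]. *)
Lemma dotv_eq_radius (u v : 'rV[R]_m) (r : R) :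
  dotv u u = r -> dotv v v = r -> (dotv u v == r) = (u == v).
Proof.
move=> hu hv; apply/eqP/eqP=> [huv|<-//].
have h0 : \sum_i (u 0 i - v 0 i) ^+ 2 = 0.
  transitivity (dotv u u + dotv v v - (dotv u v + dotv u v)); last first.
    by rewrite hu hv huv subrr.
  rewrite /dotv -!big_split -sumrB; apply: eq_bigr => i _ /=; ring.
apply/rowP=> i; apply/eqP; rewrite -subr_eq0 -sqrf_eq0.
move/eqP: h0; rewrite psumr_eq0 => [/allP h|j _]; last exact: sqr_ge0.
exact: (implyP (h i (mem_index_enum i)) isT).
Qed.

Lemma dot_in_Aprime (i j : 'I_n) : on_sphere x -> dot i j \in Aprime x.
Proof.
move=> hs; rewrite mem_undup in_cons mem_undup.
have [<-|nij] := eqVneq i j; first by rewrite hs eqxx.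
apply/orP; right; apply/mapP; exists (i, j) => //.
by rewrite mem_filter /= nij mem_enum inE.
Qed.

Lemma Aprime_dot (a : R) : on_sphere x -> (0 < n)%N -> a \in Aprime x ->
  exists i j, dot i j = a.
Proof.
move=> hs n0; rewrite mem_undup in_cons mem_undup.
case/orP=> [/eqP->|/mapP[[i j] _ ->]]; last by exists i, j.
by exists (Ordinal n0), (Ordinal n0); rewrite hs.
Qed.

Lemma radius_in_Aprime : m%:R \in Aprime x.
Proof. by rewrite mem_undup mem_head. Qed.

Lemma size_Aprime : injective x -> on_sphere x ->
  size (Aprime x) = (size (Aset x)).+1.
Proof.
move=> xI hs; rewrite /Aprime undup_id //= undup_uniq andbT mem_undup.
apply/mapP=> -[[i j]]; rewrite mem_filter /= => /andP[nij _] /esym/eqP.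
by rewrite (dotv_eq_radius (hs i) (hs j)) (inj_eq xI) (negPf nij).
Qed.

(** Double counting: each pair of points is counted at its own inner product. *)
Lemma sum_kappa (f : R -> R) : on_sphere x ->
  \sum_(a <- Aprime x) (kappa x a)%:R * f a = \sum_i \sum_j f (dot i j).
Proof.
move=> hs; rewrite pair_big /=.
transitivity (\sum_(a <- Aprime x) \sum_(ij : 'I_n * 'I_n)
                (dot ij.1 ij.2 == a)%:R * f a).
  apply: eq_bigr => a _; rewrite -mulr_suml; congr (_ * _).
  rewrite /kappa -sum1dep_card natr_sum big_mkcond /=.
  by apply: eq_bigr => ij _; case: eqP.
rewrite exchange_big /=; apply: eq_bigr => -[i j] _ /=.
rewrite (bigD1_seq (dot i j)) ?undup_uniq ?dot_in_Aprime //= eqxx mul1r.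
by rewrite big1 ?addr0 // => a /negPf; rewrite eq_sym => ->; rewrite mul0r.
Qed.

(** * Polynomials in the Gram matrix and the bilinear form [pred_ip] *)

Definition entrywise (p : {poly R}) : 'M[R]_n :=
  \matrix_(i, j) (n%:R^-1 * p.[dot i j]).

Lemma tr_entrywise p : (entrywise p)^T = entrywise p.
Proof. by apply/matrixP=> i j; rewrite !mxE dotvC. Qed.

Lemma pred_ipE p r : on_sphere x ->
  pred_ip x p r = \tr (entrywise p *m entrywise r).
Proof.
move=> hs; rewrite /pred_ip.
under eq_bigr do rewrite -mulrA.
rewrite (sum_kappa (fun a => p.[a] * r.[a])) // mulr_sumr /mxtrace.
apply: eq_bigr => i _; rewrite mxE mulr_sumr; apply: eq_bigr => j _.
by rewrite !mxE [dot j i]dotvC mulrACA -invfM expr2.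
Qed.

Lemma pred_ipC p r : pred_ip x p r = pred_ip x r p.
Proof.
rewrite /pred_ip; congr (_ * _); apply: eq_bigr => a _; ring.
Qed.

(** Multiplication by the variable is self-adjoint; this gives the three-term behaviour of the
    predegree polynomials. *)
Lemma pred_ipMX p r : pred_ip x ('X * p) r = pred_ip x p ('X * r).
Proof.
rewrite /pred_ip; congr (_ * _); apply: eq_bigr => a _.
rewrite !hornerM; ring.
Qed.

Lemma pred_ip_linear p c r t :
  pred_ip x p (c *: r + t) = c * pred_ip x p r + pred_ip x p t.
Proof.
rewrite /pred_ip [c * (_ * _)]mulrCA -mulrDr; congr (_ * _).
rewrite mulr_sumr -big_split; apply: eq_bigr => a _ /=.
rewrite hornerD hornerZ; ring.
Qed.

(** Norm zero would force [p] to vanish at every inner product, each being attained by some pair;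
    that is more roots than its degree allows. *)
Lemma pred_ip_gt0 (p : {poly R}) : injective x -> on_sphere x -> (0 < n)%N -> p != 0 ->
  (size p <= size (Aprime x))%N -> 0 < pred_ip x p p.
Proof.
move=> xI hs n0 p0 sp; rewrite pred_ipE // -[in X in _ *m X]tr_entrywise.
rewrite lt_neqAle mxtrace_mul_tr_ge0 andbT eq_sym.
apply/eqP=> /mxtrace_mul_tr_eq0 /matrixP h0.
have := max_poly_roots p0 _ (undup_uniq _ : uniq (Aprime x)).
rewrite ltnNge sp; move/(_ _)/negPf => h; suff: false by []; rewrite -h //.
apply/allP=> a /(Aprime_dot hs n0)[i [j <-]]; rewrite rootE.
move: (h0 i j); rewrite !mxE => /eqP; rewrite mulf_eq0 invr_eq0 pnatr_eq0.
by rewrite eqn0Ngt n0.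
Qed.

(** * The function spaces [Pol] and [Harm] as row spaces *)

Lemma actE (M : 'M[R]_n) f : act M f = f *m M^T.
Proof.
by apply/rowP=> j; rewrite !mxE; apply: eq_bigr => i _; rewrite !mxE mulrC.
Qed.

Lemma cipE (f g : 'rV[R]_n) : cip f g = n%:R^-1 * (f *m g^T) 0 0.
Proof.
by rewrite /cip mxE; congr (_ * _); apply: eq_bigr => i _; rewrite !mxE.
Qed.

Lemma cip_eq0 (f g : 'rV[R]_n) : (0 < n)%N -> cip f g = 0 <-> f *m g^T = 0.
Proof.
move=> n0; rewrite cipE; split=> [/eqP|->]; last by rewrite mxE mulr0.
rewrite mulf_eq0 invr_eq0 pnatr_eq0 eqn0Ngt n0 /= => /eqP h.
by apply/rowP=> j; rewrite ord1 h mxE.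
Qed.

Lemma zeta_in_gens1 a p : p \in [:: 1; 'X] -> zeta x a p \in gens1 x.
Proof. by move=> hp; apply/allpairsP; exists (a, p); rewrite mem_enum. Qed.

Lemma hprodE (f g : 'rV[R]_n) : hprod f g = g *m diag_mx f.
Proof. by apply/rowP=> j; rewrite mul_mx_diag !mxE mulrC. Qed.

(** Right multiplication by [diag_mx u] multiplies every row, seen as a function on the points, by
    [u]. *)
Lemma Pol_mul (p : nat) (A : 'M[R]_(p, n)) k u : u \in gens1 x ->
  (A <= Pol x k)%MS -> (A *m diag_mx u <= Pol x k.+1)%MS.
Proof.
move=> hu hA; apply: submx_trans (submxMr _ hA) _.
apply: bigaddsmx_seqMr_sub => v hv; rewrite -hprodE.
by apply: (sub_bigaddsmx_seq id); apply/allpairsP; exists (u, v).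
Qed.

(** The constant 1 is one of the generators of [Pol 1]; some point is needed to write it as a
    [zeta]. *)
Lemma PolS k : (0 < n)%N -> (Pol x k <= Pol x k.+1)%MS.
Proof.
move=> n0; have := Pol_mul (zeta_in_gens1 (Ordinal n0) (mem_head 1 _)) (submx_refl (Pol x k)).
rewrite (_ : diag_mx _ = 1%:M) ?mulmx1 //.
by apply/matrixP=> i j; rewrite !mxE hornerC.
Qed.

Lemma Pol_mono k l : (0 < n)%N -> (k <= l)%N -> (Pol x k <= Pol x l)%MS.
Proof.
move=> n0; elim: l => [|l IH]; first by rewrite leqn0 => /eqP->.
rewrite leq_eqVlt => /orP[/eqP->//|/IH h]; exact: submx_trans h (PolS _ n0).
Qed.

Lemma zeta_Xn_in_Pol a k : (0 < n)%N -> (zeta x a 'X^k <= Pol x k)%MS.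
Proof.
move=> n0; elim: k => [|k IH].
  rewrite (_ : zeta _ _ _ = const1 R n).
    by rewrite /Pol /= big_seq1 genmxE.
  by apply/rowP=> j; rewrite !mxE expr0 hornerC.
rewrite (_ : zeta _ _ _ = zeta x a 'X^k *m diag_mx (zeta x a 'X)).
  by apply: Pol_mul => //; rewrite zeta_in_gens1 // !inE eqxx orbT.
by rewrite -hprodE; apply/rowP=> j; rewrite !mxE exprS hornerM.
Qed.

Lemma zeta_in_Pol a k (p : {poly R}) : (0 < n)%N -> (size p <= k.+1)%N ->
  (zeta x a p <= Pol x k)%MS.
Proof.
move=> n0 sp; rewrite (_ : zeta _ _ _ = \sum_(i < size p) p`_i *: zeta x a 'X^i).
  apply: summx_sub => i _; apply/scalemx_sub.
  apply: submx_trans (zeta_Xn_in_Pol _ _ n0) (Pol_mono n0 _).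
  by rewrite -ltnS (leq_trans (ltn_ord i)).
apply/rowP=> j; rewrite summxE !mxE horner_coef.
by apply: eq_bigr => i _; rewrite !mxE hornerXn.
Qed.

Lemma entrywise_in_Pol k (p : {poly R}) : (0 < n)%N -> (size p <= k.+1)%N ->
  (entrywise p <= Pol x k)%MS.
Proof.
move=> n0 sp; apply/row_subP=> i.
rewrite (_ : row i _ = n%:R^-1 *: zeta x i p).
  exact/scalemx_sub/zeta_in_Pol.
by apply/rowP=> j; rewrite !mxE.
Qed.

(* This is where the second design identity enters: it writes the entrywise
   product with the Gram matrix as an average of two-sided multiplications. *)
Lemma entrywise_MX p : design2 x ->
  entrywise ('X * p) = n%:R^-1 *:
    \sum_z diag_mx (zeta x z 'X) *m entrywise p *m diag_mx (zeta x z 'X).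
Proof.
move=> [_ hd]; apply/matrixP=> i j; rewrite !mxE summxE hornerM hornerX -[X in X * p.[_]]hd.
rewrite mulrCA -mulrA; congr (_ * _); rewrite mulr_suml; apply: eq_bigr => z _.
rewrite mul_mx_diag mul_diag_mx !mxE !hornerX [dot i z]dotvC; ring.
Qed.

(** The kernel of the transpose of [Pol x k'] is the orthogonal complement of its row space. *)
Definition Harm_mx k : 'M[R]_n :=
  if k is k'.+1 then (Pol x k :&: kermx (Pol x k')^T)%MS else Pol x 0.

Lemma HarmP k f : (0 < n)%N -> Harm x k f <-> (f <= Harm_mx k)%MS.
Proof.
move=> n0; case: k => [|k]; first by rewrite /Harm /inPol; split=> [[]|].
rewrite sub_capmx; split=> [[fP fk]|/andP[fP fk]].
  rewrite [(f <= _)%MS]fP; apply/sub_kermxP; apply/trmx_inj; rewrite trmx0 trmx_mul trmxK.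
  apply/row_matrixP=> i; rewrite row_mul row0; apply/trmx_inj; rewrite trmx_mul trmxK trmx0.
  by apply/cip_eq0/fk => //; apply: row_sub.
split=> // g /submxP[u ->]; apply/cip_eq0 => //.
by rewrite trmx_mul mulmxA (sub_kermxP fk) mul0mx.
Qed.

(** Orthogonality of the residuals of the unit vectors says that [A *m M = A] for any [A] with rows
    in [W]. The rows of [M^T] lie in [W], so [M^T *m M = M^T], and the left side is symmetric. *)
Lemma is_orth_projP (M W : 'M[R]_n) (P : 'rV[R]_n -> Prop) : (0 < n)%N ->
  (forall f, P f <-> (f <= W)%MS) -> is_orth_proj M P ->
  [/\ M^T = M, (M <= W)%MS & W *m M = W].
Proof.
move=> n0 hP hM.
have MW : (M^T <= W)%MS.
  apply/row_subP=> i; rewrite rowE -actE; apply/hP; exact: (hM _).1.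
have orth (A : 'M[R]_n) : (A <= W)%MS -> A *m M = A.
  move=> AW; apply/row_matrixP=> j; rewrite row_mul.
  have h i : (row i 1%:M - row i M^T) *m (row j A)^T = 0.
    have /(_ (row j A)) := (hM (row i 1%:M)).2.
    rewrite actE -row_mul mul1mx => h; apply/cip_eq0/h => //.
    by apply/hP; apply: submx_trans (row_sub _ _) AW.
  have : (1%:M - M^T) *m (row j A)^T = 0.
    by apply/row_matrixP=> i; rewrite row_mul linearB /= h row0.
  move/(congr1 trmx); rewrite trmx_mul trmxK trmx0 linearB /= trmx1 trmxK.
  by rewrite mulmxBr mulmx1 => /eqP; rewrite subr_eq0 => /eqP.
have sM : M^T = M.
  have h := orth _ MW; rewrite -[RHS]trmxK -h trmx_mul trmxK; exact/esym.
by split=> //; [rewrite -sM | apply: orth].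
Qed.

Lemma kappa_radius : injective x -> on_sphere x -> kappa x m%:R = n.
Proof.
move=> xI hs; rewrite /kappa -[RHS]card_ord.
rewrite -(card_imset 'I_n (f := fun i => (i, i))); last by move=> i j [].
apply: eq_card => -[i j]; rewrite !inE /= (dotv_eq_radius (hs i) (hs j)) (inj_eq xI).
by apply/eqP/imsetP=> /= [->|[k _ [-> ->]]] //; exists j.
Qed.

Lemma adj_radius : injective x -> on_sphere x -> adj x m%:R = 1%:M.
Proof.
move=> xI hs; apply/matrixP=> i j; rewrite !mxE /Defs.rel.
by rewrite (dotv_eq_radius (hs i) (hs j)) (inj_eq xI).
Qed.

Lemma entrywise_adj p : on_sphere x ->
  entrywise p = \sum_(a <- Aprime x) (n%:R^-1 * p.[a]) *: adj x a.
Proof.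
move=> hs; apply/matrixP=> i j; rewrite summxE !mxE.
rewrite (bigD1_seq (dot i j)) ?undup_uniq ?dot_in_Aprime //= !mxE /Defs.rel eqxx mulr1.
by rewrite big1 ?addr0 // => a /negPf; rewrite !mxE /Defs.rel eq_sym => ->; rewrite mulr0.
Qed.

(** * Orthogonality and expansions for the predegree polynomials *)

Section Predegree.
Variables (s : nat) (q : nat -> {poly R}).
Hypothesis hq : predegree x s q.

Lemma size_predegree k : (k <= s)%N -> size (q k) = k.+1.
Proof. by move=> ks; have [] := hq ks ks. Qed.

Lemma predegree_neq0 k : (k <= s)%N -> q k != 0.
Proof. by move=> ks; rewrite -size_poly_gt0 size_predegree. Qed.

Lemma pred_ip_predegree k h : (k <= s)%N -> (h <= s)%N ->
  pred_ip x (q k) (q h) = if k == h then (q k).[m%:R] else 0.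
Proof. by move=> ks hs; have [] := hq ks hs. Qed.

(* For [n = 0] the form [pred_ip] is zero, since [0^-1 = 0]. *)
Lemma predegree_card_gt0 : (0 < n)%N.
Proof.
rewrite lt0n; apply/eqP=> n0; have nR0 : n%:R = 0 :> R by rewrite n0.
have := pred_ip_predegree (leq0n s) (leq0n s).
rewrite eqxx {1}/pred_ip nR0 expr0n invr0 mul0r => h.
have := predegree_neq0 (leq0n s); rewrite (size1_polyC (eq_leq (size_predegree (leq0n s)))).
move: h; rewrite {1}(size1_polyC (eq_leq (size_predegree (leq0n s)))) hornerC => <-.
by rewrite eqxx.
Qed.

(** The [q j] with [j < k] span the polynomials of degree below [k]: strong induction on the size of
    [p], removing the leading term with the [q j] of the same degree. *)
Lemma predegree_orth k (p : {poly R}) : (k <= s)%N -> (size p <= k)%N ->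
  pred_ip x (q k) p = 0.
Proof.
move=> ks; have [l] := ubnP (size p); elim: l p => // l IH p spl spk.
have [->|p0] := eqVneq p 0.
  by rewrite /pred_ip big1 ?mulr0 // => a _; rewrite horner0 mulr0.
have sp : (size p).-1.+1 = size p by rewrite prednK // size_poly_gt0.
set j := (size p).-1 in sp; have jk : (j < k)%N by rewrite sp.
have js : (j <= s)%N := leq_trans (ltnW jk) ks.
set c := lead_coef p / lead_coef (q j).
have szr : (size (p - c *: q j)%R < size p)%N.
  by rewrite -sp -(size_predegree js) size_sub_lead ?predegree_neq0 ?size_predegree.
rewrite -[p](subrK (c *: q j)) addrC pred_ip_linear pred_ip_predegree //.
rewrite gtn_eqF // mulr0 add0r IH //.
  exact: leq_trans szr _.
exact: leq_trans (ltnW szr) _.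
Qed.

Lemma pred_ip_lead k (p : {poly R}) : (k <= s)%N -> size p = k.+1 ->
  pred_ip x (q k) p = lead_coef p / lead_coef (q k) * (q k).[m%:R].
Proof.
move=> ks sp; set c := _ / _.
have szr : (size (p - c *: q k)%R <= k)%N.
  by rewrite -ltnS -(size_predegree ks) size_sub_lead ?predegree_neq0 ?size_predegree.
rewrite -[p in pred_ip _ _ p](subrK (c *: q k)) addrC pred_ip_linear.
by rewrite pred_ip_predegree // eqxx predegree_orth // addr0.
Qed.

Hypotheses (xI : injective x) (hs : on_sphere x) (sA : size (Aprime x) = s.+1).

Let n0 : (0 < n)%N := predegree_card_gt0.
Let nR : n%:R != 0 :> R. Proof. by rewrite pnatr_eq0 -lt0n. Qed.

(** This value is the squared norm of [q k], whose degree is below the number [s + 1] of inner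
    products. *)
Lemma predegree_radius_gt0 k : (k <= s)%N -> 0 < (q k).[m%:R].
Proof.
move=> ks; have := pred_ip_predegree ks ks; rewrite eqxx => <-.
by apply: pred_ip_gt0; rewrite ?predegree_neq0 // size_predegree // sA.
Qed.

(* Orthogonality of the rows of the square matrix [(q k).[a]] yields
   orthogonality of its columns. *)
Lemma predegree_dual_orth a b : a \in Aprime x -> b \in Aprime x ->
  \sum_(k < s.+1) (kappa x a)%:R * (q k).[a] * (q k).[b]
     / (n%:R ^+ 2 * (q k).[m%:R]) = (a == b)%:R.
Proof.
move=> aA bA; pose al (i : 'I_s.+1) := (Aprime x)`_i.
pose A := \matrix_(k < s.+1, i < s.+1) (q k).[al i].
(* The weights make entry [(k, h)] of [A *m B] equal to [pred_ip x (q k) (q h) / (q h).[m%:R]]. *)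
pose B := \matrix_(i < s.+1, k < s.+1)
  ((kappa x (al i))%:R * (q k).[al i] / (n%:R ^+ 2 * (q k).[m%:R])).
have AB : A *m B = 1%:M.
  apply/matrixP=> k h; rewrite !mxE.
  have ks : (k <= s)%N by rewrite -ltnS. have hs' : (h <= s)%N by rewrite -ltnS.
  transitivity (pred_ip x (q k) (q h) / (q h).[m%:R]).
    rewrite /pred_ip [in RHS](big_nth 0) sA big_mkord mulrC mulrA mulr_sumr.
    by apply: eq_bigr => i _; rewrite !mxE invfM; ring.
  rewrite pred_ip_predegree //; have [->|nkh] := eqVneq k h.
    by rewrite eqxx divff // gt_eqF // predegree_radius_gt0.
  by rewrite -val_eqE in nkh; rewrite (negPf nkh) mul0r.
have ia : (index a (Aprime x) < s.+1)%N by rewrite -sA index_mem.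
have ib : (index b (Aprime x) < s.+1)%N by rewrite -sA index_mem.
have /matrixP/(_ (Ordinal ia) (Ordinal ib)) := mulmx1C AB.
rewrite !mxE -val_eqE /= => h.
have -> : (a == b) = (index a (Aprime x) == index b (Aprime x)).
  apply/eqP/eqP=> [->//|e]; by rewrite -(nth_index 0 aA) e nth_index.
rewrite -h; apply: eq_bigr => k _; rewrite !mxE /al /= !nth_index //; ring.
Qed.

(** Dual orthogonality expands the indicator of [a] among the inner products along the [q k]. *)
Lemma adj_predegree a : a \in Aprime x ->
  adj x a = \sum_(k < s.+1)
    ((kappa x a)%:R * (q k).[a] / (n%:R * (q k).[m%:R])) *: entrywise (q k).
Proof.
move=> aA; apply/matrixP=> i j; rewrite summxE !mxE /Defs.rel eq_sym.
rewrite -(predegree_dual_orth aA (dot_in_Aprime i j hs)).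
by apply: eq_bigr => k _; rewrite !mxE !invfM; ring.
Qed.

(** Case [a = m] of the previous expansion: there [kappa] is [n], so every coefficient is 1. *)
Lemma sum_entrywise_predegree : \sum_(k < s.+1) entrywise (q k) = 1%:M.
Proof.
rewrite -adj_radius // adj_predegree ?radius_in_Aprime //.
apply: eq_bigr => k _; rewrite kappa_radius // divff ?scale1r //.
by rewrite mulf_neq0 // gt_eqF // predegree_radius_gt0 // -ltnS.
Qed.

(** Fourier expansion, valid in any degree because only the values of [p] at the [s + 1] inner
    products matter. *)
Lemma entrywise_predegree p :
  entrywise p = \sum_(k < s.+1)
    (pred_ip x p (q k) / (q k).[m%:R]) *: entrywise (q k).
Proof.
rewrite entrywise_adj //.
under eq_big_seq => a aA do rewrite adj_predegree // scaler_sumr.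
rewrite exchange_big /=; apply: eq_bigr => k _.
under eq_bigr do rewrite scalerA.
rewrite -scaler_suml; congr (_ *: _); rewrite /pred_ip -mulrA mulr_suml mulr_sumr.
by apply: eq_bigr => a _; rewrite !invfM; ring.
Qed.

(** * The projection matrices and their distance to the predegree matrices *)

Variable F : nat -> 'M[R]_n.
Hypothesis hF : forall i, (i <= s)%N -> is_orth_proj (F i) (Harm x i).

Let HarmE i f : Harm x i f <-> (f <= Harm_mx i)%MS := HarmP i f n0.

Lemma tr_proj i : (i <= s)%N -> (F i)^T = F i.
Proof. by move=> /hF/(is_orth_projP n0 (HarmE i))[]. Qed.

Lemma proj_sub_Harm i : (i <= s)%N -> (F i <= Harm_mx i)%MS.
Proof. by move=> /hF/(is_orth_projP n0 (HarmE i))[]. Qed.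

Lemma Harm_proj (p : nat) (A : 'M[R]_(p, n)) i : (i <= s)%N ->
  (A <= Harm_mx i)%MS -> A *m F i = A.
Proof.
move=> /hF/(is_orth_projP n0 (HarmE i))[_ _ h] /submxP[B ->].
by rewrite -mulmxA h.
Qed.

Lemma proj_idem i : (i <= s)%N -> F i *m F i = F i.
Proof. by move=> hi; rewrite Harm_proj // proj_sub_Harm. Qed.

Lemma proj_sub_Pol i : (i <= s)%N -> (F i <= Pol x i)%MS.
Proof.
move=> /proj_sub_Harm h; apply: submx_trans h _.
by case: i => [|i]; rewrite ?capmxSl.
Qed.

Lemma Pol_proj0 (p : nat) (A : 'M[R]_(p, n)) i j : (i < j)%N -> (j <= s)%N ->
  (A <= Pol x i)%MS -> A *m F j = 0.
Proof.
case: j => // j ij js Ai.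
have /submxP[B ->] := submx_trans Ai (Pol_mono n0 (ij : (i <= j)%N)).
rewrite -mulmxA -tr_proj // -[Pol x j]trmxK -trmx_mul.
suff /sub_kermxP-> : (F j.+1 <= kermx (Pol x j)^T)%MS by rewrite trmx0 mulmx0.
exact: submx_trans (proj_sub_Harm js) (capmxSr _ _).
Qed.

Lemma proj_Pol0 (p : nat) (A : 'M[R]_(p, n)) i j : (i < j)%N -> (j <= s)%N ->
  (A <= Pol x i)%MS -> F j *m A^T = 0.
Proof.
by move=> ij js Ai; rewrite -tr_proj // -trmx_mul (Pol_proj0 ij) ?trmx0.
Qed.

Lemma proj_orth i j : (i <= s)%N -> (j <= s)%N -> i != j -> F i *m F j = 0.
Proof.
move=> hi hj; rewrite neq_ltn => /orP[ij|ji].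
  by rewrite (Pol_proj0 ij) ?proj_sub_Pol.
by rewrite -[F j]tr_proj // (proj_Pol0 ji) ?proj_sub_Pol.
Qed.

Lemma entrywise_predegree_sub k : (k <= s)%N ->
  (entrywise (q k) <= Pol x k)%MS.
Proof. by move=> ks; apply: entrywise_in_Pol; rewrite ?size_predegree. Qed.

(** Multiply [F k] by the identity written as the sum of the [(q j)°]: for [j < k] the rows lie in
    [Pol j], which [F k] kills; for [j > k] the factor is [F j], orthogonal to [F k]. *)
Lemma proj_mul_entrywise k : (k <= s)%N ->
  (forall j, (k < j)%N -> (j <= s)%N -> F j = entrywise (q j)) ->
  F k *m entrywise (q k) = F k.
Proof.
move=> ks hj; rewrite -[RHS]mulmx1 -sum_entrywise_predegree mulmx_sumr.
rewrite (bigD1 (inord k)) //= inordK ?ltnS // big1 ?addr0 // => j.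
rewrite -val_eqE /= inordK ?ltnS // neq_ltn => /orP[jk|kj].
  rewrite -tr_entrywise (proj_Pol0 jk) // entrywise_predegree_sub //.
  exact: leq_trans (ltnW jk) ks.
have js : (j <= s)%N by rewrite -ltnS.
by rewrite -hj // proj_orth // ltn_eqF.
Qed.

Lemma norm_predegree_proj :
  \tr ((entrywise (q s) - F s) *m (entrywise (q s) - F s)^T)
    = (q s).[m%:R] - \tr (F s).
Proof.
have FH : F s *m entrywise (q s) = F s.
  by apply: proj_mul_entrywise => // j sj; rewrite leqNgt sj.
rewrite linearB /= tr_entrywise tr_proj // mulmxBl !mulmxBr FH proj_idem //.
rewrite subrr subr0 linearB /= -pred_ipE // pred_ip_predegree // eqxx.
by rewrite mxtrace_mulC FH.
Qed.

(** * Consequences of the 2-design property: [F 1] and the downward induction *)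

Hypothesis hd : design2 x.

(** The design identities make the Gram matrix [G] idempotent and orthogonal to constants. Then
    [G *m F 1 = G] because its rows lie in [Harm 1], and [F 1 *m G = F 1] because constants and the
    rows of [G] span [Pol 1]. *)
Lemma proj1_Gram : (0 < s)%N -> F 1%N = entrywise 'X.
Proof.
move=> s1; pose G := entrywise 'X; pose u := const1 R n.
have uG : u *m G = 0.
  apply/rowP=> j; rewrite !mxE.
  under eq_bigr do rewrite !mxE mul1r hornerX dotvC.
  by rewrite -mulr_sumr hd.1 mulr0.
have GG : G *m G = G.
  apply/matrixP=> i j; rewrite !mxE hornerX -[in RHS]hd.2 !mulr_sumr.
  by apply: eq_bigr => k _; rewrite !mxE !hornerX; ring.
have uu : u *m u^T = n%:R%:M.
  apply/rowP=> j; rewrite !mxE ord1 eqxx mulr1n.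
  under eq_bigr do rewrite !mxE mul1r.
  by rewrite sumr_const card_ord.
have Pol0 : (Pol x 0 <= u)%MS by rewrite /Pol /= big_seq1 genmxE.
have u0 : (u <= Pol x 0)%MS by rewrite /Pol /= big_seq1 genmxE.
have GF : G *m F 1%N = G.
  apply: Harm_proj => //; rewrite sub_capmx entrywise_in_Pol ?size_polyX //=.
  have [v ->] := submxP Pol0; apply/sub_kermxP.
  by rewrite trmx_mul mulmxA -[G]tr_entrywise -trmx_mul uG trmx0 mul0mx.
(* [P] is the projection onto the complement of [Pol 1]: remove the Gram part and the mean. *)
pose P := 1%:M - G - n%:R^-1 *: (u^T *m u).
have uP : u *m P = 0.
  rewrite !mulmxBr mulmx1 uG subr0 -scalemxAr mulmxA uu mul_scalar_mx.
  by rewrite scalerA mulVf // scale1r subrr.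
have GP : G *m P = 0.
  rewrite !mulmxBr mulmx1 GG subrr sub0r -scalemxAr mulmxA.
  by rewrite -[G]tr_entrywise -trmx_mul uG trmx0 mul0mx scaler0 oppr0.
have PP : Pol x 1 *m P = 0.
  apply/eqP; rewrite -submx0; apply: bigaddsmx_seqMr_sub.
  move=> g /allpairsP[[v w] /= [/allpairsP[[a p] /= [_ hp ->]]]].
  rewrite inE => /eqP-> ->; rewrite submx0; apply/eqP.
  have -> : hprod (zeta x a p) (const1 R n) = zeta x a p.
    by apply/rowP=> j; rewrite !mxE mulr1.
  move: hp; rewrite !inE => /orP[]/eqP->.
    by rewrite (_ : zeta x a 1 = u) //; apply/rowP=> j; rewrite !mxE hornerC.
  rewrite (_ : zeta x a 'X = n%:R *: row a G).
    by rewrite -scalemxAl -row_mul GP row0 scaler0.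
  by apply/rowP=> j; rewrite !mxE mulrA divff // mul1r.
have Fu : F 1%N *m u^T = 0 by apply: (proj_Pol0 (i := 0)).
have /submxP[B FB] := proj_sub_Pol s1.
have : F 1%N *m P = 0 by rewrite FB -mulmxA PP mulmx0.
rewrite !mulmxBr mulmx1 -scalemxAr mulmxA Fu mul0mx scaler0 subr0 => /eqP.
rewrite subr_eq0 => /eqP ->; apply: trmx_inj.
by rewrite trmx_mul tr_entrywise tr_proj // GF.
Qed.

Lemma proj_eq_entrywise : F s = entrywise (q s) ->
  forall k, (k <= s)%N -> F k = entrywise (q k).
Proof.
move=> Fs; suff IH d k : (s - k < d)%N -> (k <= s)%N -> F k = entrywise (q k).
  by move=> k; apply: IH (ltnSn _).
elim: d k => // d IH k skd; rewrite leq_eqVlt => /orP[/eqP->//|ks].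
have Fj j : (k < j)%N -> (j <= s)%N -> F j = entrywise (q j).
  move=> kj js; apply: IH => //; apply: leq_trans (_ : s - k <= d)%N => //.
  exact: ltn_sub2l.
(* The coefficient of [(q k)°] in [('X * q k.+1)°]. Moving ['X] across the form pairs [q k.+1] with
   ['X * q k], of degree exactly [k + 1]. *)
have c0 : pred_ip x ('X * q k.+1) (q k) / (q k).[m%:R] != 0.
  have szX : size ('X * q k) = k.+2.
    by rewrite mulrC size_mulX ?predegree_neq0 ?size_predegree // ltnW.
  rewrite pred_ipMX pred_ip_lead // !mulf_neq0 ?invr_eq0 //.
  - by rewrite lead_coef_eq0 -size_poly_gt0 szX.
  - by rewrite lead_coef_eq0 predegree_neq0.
  - by rewrite gt_eqF // predegree_radius_gt0.
  - by rewrite gt_eqF // predegree_radius_gt0 // ltnW.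
have low i : (i < k)%N -> Pol x i *m entrywise (q k) = 0.
  move=> ik; have : Pol x i *m entrywise ('X * q k.+1) = 0.
    rewrite entrywise_MX // -scalemxAr mulmx_sumr big1 ?scaler0 // => z _.
    (* The diagonal factor takes [Pol i] into [Pol i.+1], still killed by [F k.+1] since
       [i + 1 < k + 1]. *)
    rewrite -Fj // !mulmxA (Pol_proj0 (i := i.+1)) ?mul0mx //.
    by rewrite Pol_mul // zeta_in_gens1 // !inE eqxx orbT.
  rewrite entrywise_predegree mulmx_sumr (bigD1 (inord k)) //=.
  rewrite inordK ?ltnS ?(ltnW ks) // big1 => [|j].
    by rewrite addr0 -scalemxAr => /eqP; rewrite scaler_eq0 (negPf c0) => /eqP.
  rewrite -val_eqE /= inordK ?ltnS ?(ltnW ks) // -scalemxAr.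
  have js : (j <= s)%N by rewrite -ltnS.
  (* Terms with [j > k] die because [F j] kills [Pol i]; those with [j < k] have zero coefficient,
     as ['X * q j] has degree below [k + 1]. *)
  rewrite neq_ltn => /orP[jk|kj]; last first.
    by rewrite -Fj // (Pol_proj0 (i := i)) ?scaler0 // (ltn_trans ik).
  rewrite pred_ipMX predegree_orth ?mul0r ?scale0r //.
  by rewrite mulrC size_mulX ?predegree_neq0 ?size_predegree.
have HF : entrywise (q k) *m F k = entrywise (q k).
  apply: (Harm_proj (ltnW ks)); move: (entrywise_predegree_sub (ltnW ks)).
  case: k low {skd ks Fj c0} => // k low hk; rewrite sub_capmx hk /=.
  by apply/sub_kermxP; rewrite -tr_entrywise -trmx_mul low ?trmx0.
rewrite -(proj_mul_entrywise (ltnW ks) Fj) -[RHS]tr_entrywise.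
by rewrite -[in RHS]HF trmx_mul tr_entrywise (tr_proj (ltnW ks)).
Qed.

(** * The span of the adjacency matrices and the scheme structure *)

Lemma inBM_proj E : (forall k, (k <= s)%N -> F k = entrywise (q k)) ->
  inBM x E -> exists c : 'I_s.+1 -> R, E = \sum_k c k *: F k.
Proof.
move=> FH; pose V := \matrix_(k < s.+1) mxvec (F k).
have subV : (\sum_(a <- Aprime x) <<mxvec (adj x a)>> <= V)%MS.
  rewrite -[X in (X <= _)%MS]mulmx1; apply: bigaddsmx_seqMr_sub => a aA.
  rewrite mulmx1 adj_predegree // linear_sum; apply: summx_sub => k _.
  rewrite linearZ /=; apply: scalemx_sub; rewrite -FH ?leq_ord //.
  by rewrite -(rowK (fun k : 'I_s.+1 => mxvec (F k)) k) row_sub.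
move=> /submx_trans/(_ subV)/submxP[c cE]; exists (fun k => c 0 k).
apply: (can_inj mxvecK); rewrite cE mulmx_sum_row linear_sum.
by apply: eq_bigr => k _; rewrite rowK linearZ.
Qed.

Lemma proj_mul_comb (c : 'I_s.+1 -> R) (i : 'I_s.+1) :
  F i *m (\sum_k c k *: F k) = c i *: F i.
Proof.
rewrite mulmx_sumr (bigD1 i) //= -scalemxAr proj_idem ?leq_ord // big1 ?addr0 //.
by move=> j ji; rewrite -scalemxAr proj_orth ?scaler0 ?leq_ord // eq_sym.
Qed.

Lemma comb_mul_comb (c d : 'I_s.+1 -> R) :
  (\sum_k c k *: F k) *m (\sum_k d k *: F k) = \sum_k (c k * d k) *: F k.
Proof.
rewrite mulmx_suml; apply: eq_bigr => i _.
by rewrite -scalemxAl proj_mul_comb scalerA.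
Qed.

(** A product of two adjacency matrices is a combination of the [F k], so its entries, which are the
    intersection counts, depend only on the inner product. *)
Lemma sym_assoc_scheme_proj : (forall k, (k <= s)%N -> F k = entrywise (q k)) ->
  sym_assoc_scheme x.
Proof.
move=> FH; split.
- exists m%:R; first exact: radius_in_Aprime.
  by move=> i j; rewrite /Defs.rel (dotv_eq_radius (hs i) (hs j)) (inj_eq xI).
- move=> i j; exists (dot i j); split; first by rewrite dot_in_Aprime /Defs.rel.
  by move=> a [_ /eqP].
- by move=> a /(Aprime_dot hs n0)[i [j <-]]; exists i, j; rewrite /Defs.rel.
- by move=> a i j; rewrite /Defs.rel dotvC.
move=> a b c aA bA cA.
have [d hd'] : exists d : 'I_s.+1 -> R,
    adj x a *m adj x b = \sum_k d k *: entrywise (q k).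
  rewrite !adj_predegree //.
  under eq_bigr => k _ do rewrite -FH ?leq_ord //.
  under [X in _ *m X]eq_bigr => k _ do rewrite -FH ?leq_ord //.
  rewrite comb_mul_comb; eexists => /=.
  by apply: eq_bigr => k _; rewrite -FH ?leq_ord.
have card_adj i j : #|[set z | Defs.rel x a i z && Defs.rel x b z j]|%:R
    = (adj x a *m adj x b) i j.
  rewrite mxE -sum1dep_card natr_sum big_mkcond; apply: eq_bigr => z _.
  by rewrite !mxE -natrM mulnb; case: (_ && _).
move=> i j i' j' /eqP hij /eqP hij'; apply/eqP; rewrite -(eqr_nat R) !card_adj.
rewrite hd' !summxE; apply/eqP/eq_bigr => k _.
by rewrite !mxE hij hij'.
Qed.

Lemma primitive_idem_proj : (forall k, (k <= s)%N -> F k = entrywise (q k)) ->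
  forall E, primitive_idem x E <-> exists2 i, (i <= s)%N & E = F i.
Proof.
move=> FH E.
have F0 i : (i <= s)%N -> F i != 0.
  move=> hi; apply/eqP=> Fi0; have := predegree_radius_gt0 hi.
  have := pred_ip_predegree hi hi; rewrite eqxx pred_ipE // -FH // Fi0.
  by rewrite mul0mx mxtrace0 => <-; rewrite ltxx.
have FBM i : (i <= s)%N -> inBM x (F i).
  move=> hi; rewrite /inBM FH // entrywise_adj // linear_sum.
  rewrite big_seq; apply: summx_sub => a aA; rewrite linearZ /=; apply: scalemx_sub.
  exact: (sub_bigaddsmx_seq (fun a => mxvec (adj x a))).
(* Multiplying by [F i] compares coefficients: [c i ^+ 2 = c i]. *)
have idem01 (E' : 'M[R]_n) (c : 'I_s.+1 -> R) i :
    E' = \sum_k c k *: F k -> E' *m E' = E' -> c i = 0 \/ c i = 1.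
  move=> E'E; rewrite E'E => /(congr1 (mulmx (F i))).
  rewrite mulmxA !proj_mul_comb -scalemxAl proj_mul_comb scalerA => /eqP.
  rewrite -subr_eq0 -scalerBl scaler_eq0 (negPf (F0 _ _)) ?leq_ord // orbF.
  rewrite -{3}[c i]mulr1 -mulrBr mulf_eq0 subr_eq0.
  by case/orP=> /eqP; [left|right].
split=> [[EBM EE E0 Emin]|[i hi ->]].
  have [c Ec] := inBM_proj FH EBM.
  (* A nonzero idempotent has some coefficient 1; minimality then identifies it with that [F k]. *)
  have /existsP[k /eqP ck] : [exists k, c k == 1].
    apply: contraT; rewrite negb_exists => /forallP c1.
    case/eqP: E0; rewrite Ec big1 // => k _.
    have [->|ck] := idem01 _ _ k Ec EE; first by rewrite scale0r.
    by move: (c1 k); rewrite ck eqxx.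
  have ks := leq_ord k; exists (nat_of_ord k) => //.
  have FE : F k *m E = F k by rewrite Ec proj_mul_comb ck scale1r.
  case: (Emin _ (FBM _ ks) (proj_idem ks) FE) => [Fk0|->//].
  by move: (F0 _ ks); rewrite Fk0 eqxx.
split; [exact: FBM | exact: proj_idem | exact: F0 |].
move=> E' /(inBM_proj FH)[c E'c] E'E' E'F.
(* [E'] is symmetric, so transposing turns [E' *m F i = E'] into [F i *m E'], which extracts one
   coefficient. *)
have E'i : E' = c (inord i) *: F i.
  have := proj_mul_comb c (inord i); rewrite -E'c inordK // => FE'.
  have : (E' *m F i)^T = (F i *m E')^T^T.
    rewrite trmx_mul tr_proj // trmxK; congr (_ *m _).
    rewrite E'c linear_sum; apply: eq_bigr => k _.
    by rewrite linearZ /= tr_proj ?leq_ord.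
  by rewrite trmxK FE' => /(congr1 trmx); rewrite trmxK E'F linearZ /= tr_proj.
by case: (idem01 _ _ (inord i) E'c E'E') E'i => ->;
  [rewrite scale0r; left | rewrite scale1r; right].
Qed.

Lemma qpoly_scheme_proj : (0 < s)%N ->
  (forall k, (k <= s)%N -> F k = entrywise (q k)) -> qpoly_scheme x s F.
Proof.
move=> s1 FH; split; first exact: sym_assoc_scheme_proj.
  exact: primitive_idem_proj.
move=> i hi; exists (q i); split; first exact: size_predegree.
move=> a b; rewrite proj1_Gram // FH // !mxE hornerX.
by rewrite !mulrA divff // !mul1r.
Qed.

(** * From a polynomial form of [F s] back to [q s]; positivity of [s] *)

Lemma proj_entrywise_eq (v : {poly R}) : size v = s.+1 ->
  F s = entrywise v -> F s = entrywise (q s).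
Proof.
move=> sv Fv; set c := lead_coef v / lead_coef (q s).
have v0 : v != 0 by rewrite -size_poly_gt0 sv.
have Fv_low (p : {poly R}) : (size p <= s)%N -> pred_ip x v p = 0.
  (* For [s = 0] there is no [Pol] below, but then [p] is zero. *)
  case: s Fv (@proj_Pol0 n) => [|s'] Fv' h.
    rewrite leqn0 size_poly_eq0 => /eqP->.
    by rewrite /pred_ip big1 ?mulr0 // => a _; rewrite horner0 mulr0.
  move=> sp; rewrite pred_ipE // -Fv' -[entrywise p]tr_entrywise.
  by rewrite (h _ s') ?mxtrace0 // entrywise_in_Pol.
pose r := v - c *: q s.
have sr : (size r <= s)%N.
  by rewrite -ltnS -(size_predegree (leqnn s)) size_sub_lead ?predegree_neq0 ?size_predegree.
(* Both [v] and [q s] are orthogonal to lower degrees, so [r] is orthogonal to itself. *)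
have r0 : r = 0.
  apply/eqP/contraT=> r0.
  have : 0 < pred_ip x r r by apply: pred_ip_gt0 => //; rewrite sA ltnW.
  rewrite {2}/r addrC -scaleNr pred_ip_linear [pred_ip x r (q s)]pred_ipC.
  by rewrite predegree_orth // mulr0 add0r pred_ipC Fv_low // ltxx.
have Fc : F s = c *: entrywise (q s).
  rewrite Fv; move/eqP: r0; rewrite subr_eq0 => /eqP->.
  by apply/matrixP=> i j; rewrite !mxE hornerZ mulrCA.
have FH : F s *m entrywise (q s) = F s.
  by apply: proj_mul_entrywise => // j sj; rewrite leqNgt sj.
have c0 : c != 0.
  by rewrite mulf_neq0 ?invr_eq0 ?lead_coef_eq0 ?predegree_neq0.
apply: (scalerI c0); rewrite -Fc -[in LHS]FH scalemxAr -Fc.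
exact: proj_idem.
Qed.

(** With [m] as the only inner product, a row of inner products would sum to [n m], not to 0. *)
Lemma card_Aset_gt0 : (0 < m)%N -> (0 < s)%N.
Proof.
move=> m0; rewrite lt0n; apply/eqP=> s0; move: sA; rewrite s0 => sA1.
have Am a : a \in Aprime x -> a = m%:R.
  move: radius_in_Aprime; case: (Aprime x) sA1 => [|b []] // _.
  by rewrite !inE => /eqP-> /eqP->.
have /eqP := hd.1 (Ordinal n0); rewrite (eq_bigr (fun=> m%:R)) => [|j _].
  rewrite sumr_const card_ord -[_ *+ n]mulr_natl mulf_eq0 (negPf nR).
  by rewrite pnatr_eq0 -leqn0 leqNgt m0.
exact/Am/dot_in_Aprime.
Qed.

End Predegree.

End SphericalSet.

Theorem theorem4p1 (R : realType) (m n : nat) (x : 'I_n -> 'rV[R]_m)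
    (s : nat) (F : nat -> 'M[R]_n) (q : nat -> {poly R}) :
  (1 <= m)%N ->
  injective x ->
  on_sphere x ->
  design2 x ->
  size (Aset x) = s ->
  is_degree x s ->
  (forall i, (i <= s)%N -> is_orth_proj (F i) (Harm x i)) ->
  predegree x s q ->
  let ms := fun a : 'I_n => n%:R * F s a a in
  [/\ \tr (F s) = n%:R^-1 * \sum_(a < n) ms a,
      \tr (F s) <= (q s).[m%:R] &
      (\tr (F s) = (q s).[m%:R] <-> qpoly_scheme x s F)].
Proof.
move=> m1 xI hs hd sA _ hF hq ms.
have n0 := predegree_card_gt0 hq.
have nR : n%:R != 0 :> R by rewrite pnatr_eq0 -lt0n.
have sA' : size (Aprime x) = s.+1 by rewrite size_Aprime // sA.
have s1 := card_Aset_gt0 hq hs sA' hd m1.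
have norm := norm_predegree_proj hq xI hs sA' hF.
split.
- by rewrite -mulr_sumr mulrA mulVf // mul1r.
- by rewrite -subr_ge0 -norm mxtrace_mul_tr_ge0.
split=> [trE|[_ _ hv]].
  move: norm; rewrite trE subrr => /mxtrace_mul_tr_eq0/eqP.
  rewrite subr_eq0 => /eqP/esym Fs.
  apply: (qpoly_scheme_proj hq) => //.
  exact: (proj_eq_entrywise hq xI hs sA' hF hd Fs).
have [v [sv vF]] := hv s (leqnn s).
(* The entries of [n F 1] are the inner products themselves, so the scheme polynomial of index [s]
   expresses [F s] as [v°]. *)
have Fv : F s = entrywise x v.
  apply/matrixP=> i j; rewrite mxE; apply: (mulfI nR); rewrite vF.
  by rewrite (proj1_Gram hq hF hd s1) !mxE hornerX !mulrA divff // !mul1r.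
have Fs := proj_entrywise_eq hq xI hs sA' hF sv Fv.
move/eqP: norm; rewrite -Fs subrr mul0mx mxtrace0 eq_sym subr_eq0 => /eqP.
exact: esym.
Qed.
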